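(* Let $n,k$ be integers such that $n\ge 2$ and $n-1\ge k\ge 1$. Let $s\ge 1$, let $3\le i_1<i_2<\dots<i_s\le n+1$ be integers and let $m_1,\dots,m_s$ be positive integers such that $\sum_{j=1}^s m_j=k$ and $\sum_{j=1}^s i_jm_j=n+2k-1$. Given a convex polygon with $n+1$ labelled edges, the number of its dissections of type $(i_1^{m_1},i_2^{m_2},\dots,i_s^{m_s})$ by $k-1$ diagonals is $$\frac{(n+k-1)!}{n!\,m_1!\,m_2!\cdots m_s!}.$$
   Context: A dissection of a convex polygon with $n+1$ labelled edges by $k-1$ diagonals is a set of $k-1$ distinct diagonals (segments joining two non-adjacent vertices) no two of which intersect in their interiors; it divides the polygon into $k$ polygons. Since the edges are labelled, the polygon is fixed and dissections differing by a rotation or reflection are counted as different. The dissection is said to be of type $(i_1^{m_1},i_2^{m_2},\dots,i_s^{m_s})$, with $3\le i_1<i_2<\dots<i_s\le n+1$, if it is made of exactly $m_j$ polygons with $i_j$ edges for every $j=1,\dots,s$. *)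

(* Defs.v *)
From HB Require Import structures.
From mathcomp Require Import all_boot all_order all_algebra.
From mathcomp Require Import boolp.

Set Implicit Arguments.
Unset Strict Implicit.
Unset Printing Implicit Defensive.

Import Order.TTheory GRing.Theory Num.Theory.

Local Open Scope ring_scope.

Section Polygon.

Variables (R : realFieldType) (N : nat).

(* Twice the signed area of the triangle a b c. *)
Definition orient (a b c : 'rV[R]_2) : R :=
  (b 0 0 - a 0 0) * (c 0 1 - a 0 1) - (b 0 1 - a 0 1) * (c 0 0 - a 0 0).

(* The vertices p 0, p 1, ..., p (N - 1) are numbered counterclockwise; strict
   inequality means that no three of them are collinear. *)
Definition convex_polygon (p : 'I_N -> 'rV[R]_2) : Prop :=
  forall a b c : 'I_N, (a < b)%N -> (b < c)%N -> 0 < orient (p a) (p b) (p c).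

(* [enum V] lists V in increasing order, i.e. in the order in which its vertices
   occur along the polygon, and [next] closes that list up cyclically.  A side
   is represented by the set of its two endpoints. *)
Definition sides (V : {set 'I_N}) : {set {set 'I_N}} :=
  [set [set a; next (enum V) a] | a in V].

Definition is_diagonal (d : {set 'I_N}) : bool :=
  (#|d| == 2) && (d \notin sides [set: 'I_N]).

(* Strictly positive convex combinations: the open segment when V has two
   elements, the interior of the convex polygon with vertex set V when V has at
   least three. *)
Definition in_interior (p : 'I_N -> 'rV[R]_2) (V : {set 'I_N})
    (x : 'rV[R]_2) : Prop :=
  exists w : 'I_N -> R,
    [/\ forall i, i \in V -> 0 < w i,
        \sum_(i in V) w i = 1
      & x = \sum_(i in V) w i *: p i].

Definition interiors_meet (p : 'I_N -> 'rV[R]_2) (U V : {set 'I_N}) : Prop :=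
  exists x, in_interior p U x /\ in_interior p V x.

Definition is_dissection (p : 'I_N -> 'rV[R]_2) (D : {set {set 'I_N}}) : Prop :=
  (forall d, d \in D -> is_diagonal d) /\
  (forall d e, d \in D -> e \in D -> d != e -> ~ interiors_meet p d e).

(* V is the vertex set of one of the polygons into which D divides the polygon:
   it is bounded by edges and diagonals of D, and no diagonal of D enters it. *)
Definition is_piece (p : 'I_N -> 'rV[R]_2) (D : {set {set 'I_N}})
    (V : {set 'I_N}) : Prop :=
  [/\ (3 <= #|V|)%N,
      sides V \subset sides [set: 'I_N] :|: D
    & forall d, d \in D -> ~ interiors_meet p d V].

Definition pieces (p : 'I_N -> 'rV[R]_2) (D : {set {set 'I_N}}) :
    {set {set 'I_N}} :=
  [set V | `[< is_piece p D V >]].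

Definition has_type (p : 'I_N -> 'rV[R]_2) (D : {set {set 'I_N}})
    (s : nat) (i m : 'I_s -> nat) : Prop :=
  (forall j, #|[set V in pieces p D | #|sides V| == i j]| = m j) /\
  (forall V, V \in pieces p D -> exists j, #|sides V| = i j).

Definition dissections_of_type (p : 'I_N -> 'rV[R]_2) (r : nat)
    (s : nat) (i m : 'I_s -> nat) : {set {set {set 'I_N}}} :=
  [set D | `[< [/\ is_dissection p D, #|D| = r & has_type p D i m] >]].

End Polygon.

(* Main.v *)
(* In a convex polygon an open diagonal meets the interior of the polygon spanned
   by a set of vertices exactly when that set has vertices strictly on both sides
   of the diagonal, so everything becomes a statement about subsets of
   {0, ..., N - 1}.  A diagonal that can be added to a dissection lies in a
   unique piece, and cuts that piece, with w edges, into two pieces with x and y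
   edges, x + y = w + 2.  Conversely a polygon with w vertices has y - 1
   diagonals that leave x vertices between their endpoints (endpoints included).
   Let t(v) be the prescribed number of pieces with v edges, and N(t) the number
   of dissections of type t.  Counting the pairs (dissection of type t, one of
   its diagonals) by the dissection left after deleting the diagonal gives
     (k - 1) N(t) = sum over (x, y) of (y - 1) t'(w) N(t'),
   where t' is t with one x and one y replaced by one w = x + y - 2.  The formula
     N(t) n! prod_v t(v)! = (n + k - 1)!
   follows by induction on k, because t'(w) / prod_v t'(v)! equals
   t(x) (t(y) - [x = y]) / prod_v t(v)!, and the sum over (x, y) of
   (y - 1) t(x) (t(y) - [x = y]) is (k - 1) (n + k - 1). *)
Require Import Defs.
From HB Require Import structures.
From mathcomp Require Import all_boot all_order all_algebra.
From mathcomp Require Import boolp zify ring.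

Set Implicit Arguments.
Unset Strict Implicit.
Unset Printing Implicit Defensive.

Import Order.TTheory GRing.Theory Num.Theory.

(** * Chords of a set of vertices *)

Section Chords.

Variable N : nat.
Implicit Types (a b x y : 'I_N) (c d e V W : {set 'I_N}).

(* Phrased without naming the endpoints of [d]; meant for [#|d| = 2]. *)
Definition inn d x : bool :=
  [&& x \notin d, [exists a in d, a < x] & [exists b in d, x < b]].

Definition out d x : bool := (x \notin d) && ~~ inn d x.

(** For a chord [d], the set [V] has vertices strictly on both sides of it. When [V] is itself a
    chord this is crossing, a symmetric relation by [cuts_sym]. *)
Definition cuts d V : bool :=
  [exists x in V, inn d x] && [exists y in V, out d y].

Lemma ord_eqE x y : (x == y) = (val x == val y).
Proof. by []. Qed.

Lemma inn2 a b x : a < b -> inn [set a; b] x = (a < x < b).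
Proof.
move=> ab; apply/idP/idP.
  case/and3P=> _ /existsP[u /andP[+ ux]] /existsP[v /andP[+ xv]].
  rewrite !inE => /orP[/eqP eu|/eqP eu] /orP[/eqP ev|/eqP ev]; subst u v; lia.
move=> /andP[ax xb]; apply/and3P; split.
- rewrite !inE !ord_eqE /=; lia.
- by apply/existsP; exists a; rewrite !inE eqxx.
- by apply/existsP; exists b; rewrite !inE eqxx orbT.
Qed.

Lemma out2 a b x : a < b -> out [set a; b] x = (x < a) || (b < x).
Proof. move=> ab; rewrite /out inn2 // !inE !ord_eqE /=; lia. Qed.

Lemma card2P d : reflect (exists a b, a < b /\ d = [set a; b]) (#|d| == 2).
Proof.
apply: (iffP (cards2P d)) => [[a [b [nab ->]]]|[a [b [ab ->]]]].
  case: (ltngtP a b) => ab.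
  - by exists a, b.
  - by exists b, a; rewrite setUC.
  - by rewrite (val_inj ab) eqxx in nab.
by exists a, b; split=> //; rewrite ord_eqE /=; lia.
Qed.

Lemma cutsP d V :
  reflect (exists x y, [/\ x \in V, y \in V, inn d x & out d y]) (cuts d V).
Proof.
apply: (iffP andP) => [[/existsP[x /andP[xV dx]] /existsP[y /andP[yV dy]]]|].
  by exists x, y.
case=> x [y [xV yV dx dy]]; split; apply/existsP.
  by exists x; rewrite xV.
by exists y; rewrite yV.
Qed.

Lemma cuts_mono d V W : V \subset W -> cuts d V -> cuts d W.
Proof.
move/subsetP=> VW /cutsP[x [y [xV yV dx dy]]].
by apply/cutsP; exists x, y; split=> //; apply: VW.
Qed.

Lemma cuts_id d : cuts d d = false.
Proof. by apply/cutsP=> -[x [y [xd _]]]; rewrite /inn xd. Qed.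

Lemma cuts_symW d e : #|d| == 2 -> #|e| == 2 -> cuts d e -> cuts e d.
Proof.
case/card2P=> a [b [ab ->]] /card2P[u [v [uv ->]]].
move=> /cutsP[x [y []]]; rewrite inn2 // out2 // !inE => ex ey dx dy.
apply/cutsP.
have [h|h] : inn [set u; v] a && out [set u; v] b \/
         inn [set u; v] b && out [set u; v] a.
  rewrite !inn2 // !out2 //.
  case/orP: ex => /eqP ex; case/orP: ey => /eqP ey; subst x y; lia.
- by case/andP: h => ? ?; exists a, b; rewrite !inE !eqxx orbT.
- by case/andP: h => ? ?; exists b, a; rewrite !inE !eqxx orbT.
Qed.

Lemma cuts_sym d e : #|d| == 2 -> #|e| == 2 -> cuts d e = cuts e d.
Proof. by move=> hd he; apply/idP/idP; apply: cuts_symW. Qed.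

(** Weak separation: opposite closed sides of the chord [d], whose endpoints may be shared. *)
Definition wsep d V W : bool :=
  [forall x in V, ~~ inn d x] && [forall x in W, ~~ out d x] ||
  [forall x in V, ~~ out d x] && [forall x in W, ~~ inn d x].

Lemma wsepP d V W : reflect
  ((forall x, x \in V -> ~~ inn d x) /\ (forall x, x \in W -> ~~ out d x) \/
   (forall x, x \in V -> ~~ out d x) /\ (forall x, x \in W -> ~~ inn d x))
  (wsep d V W).
Proof.
apply: (iffP orP) => -[].
- by case/andP=> /forall_inP ? /forall_inP ?; left.
- by case/andP=> /forall_inP ? /forall_inP ?; right.
- by case=> ? ?; left; apply/andP; split; apply/forall_inP.
- by case=> ? ?; right; apply/andP; split; apply/forall_inP.
Qed.

Lemma wsep_sym d V W : wsep d V W = wsep d W V.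
Proof. by rewrite /wsep orbC ![[forall x in V, _] && _]andbC. Qed.

(** Both endpoints of [c] lie in one closed arc bounded by [d]; the opposite closed arc, which
    contains [W], stays on one side of [c]. *)
Lemma wsep_cuts c d V W : #|c| == 2 -> #|d| == 2 -> c \subset V ->
  wsep d V W -> ~~ cuts c W.
Proof.
case/card2P=> a [b [ab ->]] /card2P[u [v [uv ->]]] /subsetP cV.
have aV : a \in V by apply: cV; rewrite !inE eqxx.
have bV : b \in V by apply: cV; rewrite !inE eqxx orbT.
move=> sep; apply/negP=> /cutsP[x [y [xW yW]]].
rewrite inn2 // out2 // => cx cy.
by case/wsepP: sep => -[hV hW];
  move: (hV _ aV) (hV _ bV) (hW _ xW) (hW _ yW); rewrite !inn2 // !out2 //; lia.
Qed.

Lemma wsep_meet d V W : wsep d V W -> V :&: W \subset d.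
Proof.
move=> sep; apply/subsetP=> x; rewrite inE => /andP[xV xW].
apply: contraT => xd.
by case/wsepP: sep => -[/(_ _ xV) + /(_ _ xW)]; rewrite /out xd /= => /negPf->.
Qed.

(** A description of sides that avoids the cyclic enumeration; [sidesE] identifies it with
    [sides]. *)
Definition edge V d : bool := [&& #|d| == 2, d \subset V & ~~ cuts d V].

Lemma set_bounds V : 2 <= #|V| -> exists l r,
  [/\ l \in V, r \in V, l < r & forall v, v \in V -> l <= v <= r].
Proof.
move=> V2; have [v0 v0V] : exists v0, v0 \in V by apply/card_gt0P; lia.
case: (@arg_maxnP _ v0 [pred v | v \in V] val v0V) => r /= rV rmax.
case: (@arg_minnP _ v0 [pred v | v \in V] val v0V) => l /= lV lmin.
exists l, r; split=> // [|v vV]; last by rewrite lmin //=; exact: rmax.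
rewrite ltn_neqAle lmin // andbT; apply: contraTneq V2 => /val_inj elr.
rewrite -leqNgt -(cards1 l); apply/subset_leq_card/subsetP=> v vV.
rewrite inE; apply/eqP/val_inj/eqP; rewrite eqn_leq lmin // elr.
by move: (rmax v vV) => /= ->.
Qed.

(** The edge facing [x] joins the vertices of [V] cyclically just before and just after [x]: linear
    neighbours if [V] has elements below and above [x], the minimum and maximum of [V] otherwise. *)
Lemma edge_gap V x : 2 <= #|V| -> x \notin V -> exists2 d, edge V d &
  inn d x && [forall v in V, ~~ inn d v] ||
  out d x && [forall v in V, ~~ out d v].
Proof.
move=> V2 xV.
have [/andP[/existsP[l0 hl0] /existsP[r0 hr0]]|lohi] :=
    boolP ([exists v in V, v < x] && [exists v in V, x < v]).
  case: (@arg_maxnP _ l0 [pred v | (v \in V) && (v < x)] val hl0) => l.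
  move=> /andP[lV lx] lmax.
  case: (@arg_minnP _ r0 [pred v | (v \in V) && (x < v)] val hr0) => r.
  move=> /andP[rV xr] rmin.
  have lr : l < r by lia.
  have nin : [forall v in V, ~~ inn [set l; r] v].
    apply/forall_inP=> v vV; rewrite inn2 //; apply/negP=> /andP[lv vr].
    have [xv|vx|xv] := ltngtP x v.
    + by have := rmin v; rewrite /= vV xv => /(_ isT); lia.
    + by have := lmax v; rewrite /= vV vx => /(_ isT); lia.
    + by move: xV; rewrite (val_inj xv) vV.
  exists [set l; r]; last by rewrite nin inn2 // lx xr.
  apply/and3P; split; first by apply/card2P; exists l, r.
    by rewrite subUset !sub1set lV.
  by apply/cutsP=> -[y [z [yV _ dy _]]]; have := forall_inP nin _ yV; rewrite dy.
have [l [r [lV rV lr bnd]]] := set_bounds V2.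
have nout : [forall v in V, ~~ out [set l; r] v].
  by apply/forall_inP=> v vV; rewrite out2 //; have := bnd _ vV; lia.
exists [set l; r].
  apply/and3P; split; first by apply/card2P; exists l, r.
    by rewrite subUset !sub1set lV.
  by apply/cutsP=> -[z [y [_ yV _ dy]]]; have := forall_inP nout _ yV; rewrite dy.
rewrite nout out2 // !andbT; apply/orP; right.
apply: contraNT lohi; rewrite negb_or -!leqNgt => /andP[lx xr].
have nx v : v \in V -> val v != val x.
  by move=> vV; apply: contraNneq xV => /val_inj <-.
apply/andP; split; apply/existsP.
  by exists l; rewrite lV; have := nx _ lV => /=; lia.
by exists r; rewrite rV; have := nx _ rV => /=; lia.
Qed.

End Chords.

(** * Pieces of a noncrossing set of diagonals *)

Section Pieces.

Variable N : nat.
Implicit Types (a b x y : 'I_N) (c d e V W : {set 'I_N}) (D E : {set {set 'I_N}}).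

Definition diag d : bool := (#|d| == 2) && cuts d setT.

(** The combinatorial form of [is_piece]; [is_pieceE] proves the equivalence for noncrossing [D]. *)
Definition cpiece D V : bool :=
  [&& 3 <= #|V|, [forall d, edge V d ==> edge setT d || (d \in D)]
    & [forall d in D, ~~ cuts d V]].

Definition cpieces D : {set {set 'I_N}} := [set V | cpiece D V].

Definition noncrossing D : bool :=
  [forall d in D, diag d] && [forall d in D, forall e in D, ~~ cuts d e].

Lemma cpieceP D V : reflect
  [/\ 3 <= #|V|, forall d, edge V d -> edge setT d \/ d \in D
    & forall d, d \in D -> ~~ cuts d V] (cpiece D V).
Proof.
apply: (iffP and3P) => -[V3].
  move=> /forallP sV /forall_inP cV; split=> // d dV.
  by apply/orP; move: (sV d); rewrite dV.
move=> sV cV; split=> //; last exact/forall_inP.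
by apply/forallP=> d; apply/implyP=> /sV /orP.
Qed.

Lemma noncrossingP D : reflect
  ((forall d, d \in D -> diag d) /\
   (forall d e, d \in D -> e \in D -> ~~ cuts d e)) (noncrossing D).
Proof.
apply: (iffP andP) => -[/= dD cD].
  split; first exact/forall_inP.
  by move=> d e dd; move: e; apply/forall_inP; apply: (forall_inP cD).
split; first exact/forall_inP.
by apply/forall_inP=> d dd; apply/forall_inP=> e; apply: cD.
Qed.

Lemma noncrossing_sub D E : D \subset E -> noncrossing E -> noncrossing D.
Proof.
move/subsetP=> DE /noncrossingP[dE cE]; apply/noncrossingP.
by split=> [d /DE|d e /DE dd /DE]; [apply: dE|apply: cE].
Qed.

Lemma edge_setT_cuts d V : edge setT d -> ~~ cuts d V.
Proof. by case/and3P=> _ _; apply: contra; apply/cuts_mono/subsetT. Qed.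

Lemma subset_card3 d V : #|d| == 2 -> 3 <= #|V| -> ~~ (V \subset d).
Proof. by move/eqP=> d2 V3; apply/negP=> /subset_leq_card; lia. Qed.

Lemma inn_or_out d x : [|| x \in d, inn d x | out d x].
Proof. by rewrite /out; case: (x \in d); case: inn. Qed.

Lemma inn_notin d x : inn d x -> x \notin d.
Proof. by case/and3P. Qed.

Lemma inn_out d x : inn d x -> ~~ out d x.
Proof. by rewrite /out => ->; rewrite andbF. Qed.

Lemma no_inn_out_sub d V : (forall x, x \in V -> ~~ inn d x) ->
  (forall x, x \in V -> ~~ out d x) -> V \subset d.
Proof.
move=> ni no; apply/subsetP=> x xV; have := inn_or_out d x.
by rewrite (negPf (ni _ xV)) (negPf (no _ xV)) !orbF.
Qed.

(** The separator is the edge of [V] that faces a vertex [x] of [W] outside [V]. It belongs to [D],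
    so it does not cut [W], and all of [W] stays on the side of [x]. *)
Lemma cpieces_not_sub D V W : cpiece D V -> cpiece D W -> ~~ (W \subset V) ->
  exists e, [/\ e \in D, #|e| == 2 & wsep e V W].
Proof.
move=> /cpieceP[V3 sV cV] /cpieceP[W3 sW cW] /subsetPn[x xW xV].
have [d dV gap] := edge_gap (ltnW V3) xV.
have d2 : #|d| == 2 by case/and3P: dV.
exists d; rewrite d2.
have ncW : ~~ cuts d W.
  by case: (sV _ dV) => [/edge_setT_cuts|/cW].
(* An edge of the whole polygon has all vertices on one closed side. Since [x] is strictly beyond
   [d] and [V] is not, [V] would reduce to the endpoints of [d]. *)
have dD : d \in D.
  case: (sV _ dV) => // dT; case/negP: (subset_card3 d2 V3).
  have /cutsP nc := edge_setT_cuts setT dT.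
  apply: no_inn_out_sub => y yV; apply/negP=> dy; case/orP: gap.
  - by case/andP=> _ /forall_inP/(_ _ yV); rewrite dy.
  - by case/andP=> dx _; apply: nc; exists y, x; split; rewrite ?in_setT.
  - by case/andP=> dx _; apply: nc; exists x, y; split; rewrite ?in_setT.
  - by case/andP=> _ /forall_inP/(_ _ yV); rewrite dy.
split=> //; apply/wsepP; case/orP: gap => /andP[dx /forall_inP h]; [left|right].
  by split=> // y yW; apply: contra ncW => dy; apply/cutsP; exists x, y.
by split=> // y yW; apply: contra ncW => dy; apply/cutsP; exists y, x.
Qed.

Lemma cpieces_wsep D V W : cpiece D V -> cpiece D W -> V != W ->
  exists e, [/\ e \in D, #|e| == 2 & wsep e V W].
Proof.
move=> pV pW; rewrite eqEsubset negb_and orbC => /orP[|] h.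
  exact: cpieces_not_sub h.
have [e [eD e2 sep]] := cpieces_not_sub pW pV h.
by exists e; rewrite wsep_sym.
Qed.

Lemma eq_subset2 d e : #|d| == 2 -> #|e| == 2 -> d \subset e -> d = e.
Proof. by move=> /eqP d2 /eqP e2 de; apply/eqP; rewrite eqEcard de d2 e2. Qed.

(** A diagonal separating two distinct pieces contains their intersection, hence [d], and so equals
    [d]; but [d] is not in [D]. *)
Lemma cpiece_chord_uniq D V W d : cpiece D V -> cpiece D W -> #|d| == 2 ->
  d \notin D -> d \subset V -> d \subset W -> V = W.
Proof.
move=> pV pW d2 dD dV dW; apply/eqP; apply: contraNT dD.
case/(cpieces_wsep pV pW)=> e [eD e2 /wsep_meet VWe].
rewrite (@eq_subset2 d e) //; apply: subset_trans VWe.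
by rewrite subsetI dV.
Qed.

(** Only the strictly opposite side is discarded, so both parts keep the endpoints of a chord [d] of
    [V]. The left part is the one numbered between these endpoints. *)
Definition left_part d V : {set 'I_N} := [set x in V | ~~ out d x].
Definition right_part d V : {set 'I_N} := [set x in V | ~~ inn d x].

(** * Cutting one piece along a chord *)

Section Split.

Variables (D : {set {set 'I_N}}) (V d : {set 'I_N}).
Hypotheses (pV : cpiece D V) (d2 : #|d| == 2) (dV : d \subset V)
  (cdV : cuts d V).

Lemma chord_notin : d \notin D.
Proof. by apply: contraL cdV => dD; case/cpieceP: pV => _ _; apply. Qed.

Lemma sub_left : left_part d V \subset V.
Proof. by apply/subsetP=> x; rewrite inE => /andP[]. Qed.

Lemma sub_right : right_part d V \subset V.
Proof. by apply/subsetP=> x; rewrite inE => /andP[]. Qed.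

Lemma chord_left : d \subset left_part d V.
Proof.
by apply/subsetP=> x xd; rewrite inE (subsetP dV) //= /out xd.
Qed.

Lemma chord_right : d \subset right_part d V.
Proof.
by apply/subsetP=> x xd; rewrite inE (subsetP dV) //= /inn xd.
Qed.

Lemma left_part_inn : exists2 x, x \in left_part d V & inn d x.
Proof.
case/cutsP: cdV => x [y [xV yV dx dy]]; exists x => //.
by rewrite inE xV inn_out.
Qed.

Lemma right_part_out : exists2 x, x \in right_part d V & out d x.
Proof.
case/cutsP: cdV => x [y [xV yV dx dy]]; exists y => //.
by rewrite inE yV; apply: contraL dy; apply: inn_out.
Qed.

Lemma card_parts : #|left_part d V| + #|right_part d V| = #|V| + 2.
Proof.
have EU : left_part d V :|: right_part d V = V.
  apply/setP=> x; rewrite !inE; case: (x \in V) => //=.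
  by case: (boolP (inn d x)) => [/inn_out->|]; rewrite ?orbT.
have EI : left_part d V :&: right_part d V = d.
  apply/eqP; rewrite eqEsubset subsetI chord_left chord_right !andbT.
  by apply: no_inn_out_sub => x; rewrite !inE => /andP[/andP[_ ?] /andP[_ ?]].
by rewrite -cardsUI EU EI (eqP d2).
Qed.

Lemma card_left : 3 <= #|left_part d V|.
Proof.
have [x xl dx] := left_part_inn.
rewrite -ltnS -(eqP d2); apply: proper_card; rewrite properE chord_left.
by apply/subsetPn; exists x => //; apply: inn_notin.
Qed.

Lemma card_right : 3 <= #|right_part d V|.
Proof.
have [x xr dx] := right_part_out.
rewrite -ltnS -(eqP d2); apply: proper_card; rewrite properE chord_right.
by apply/subsetPn; exists x => //; case/andP: dx.
Qed.

(** If [e] cuts [V] but not the left part, the vertex of [V] strictly inside [e] belongs to the left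
    part. Neither endpoint of [d] can then lie strictly outside [e], while [e] lies within the range
    of [d]; hence [e = d]. *)
Lemma edge_left e : edge (left_part d V) e -> edge V e \/ e = d.
Proof.
case/and3P=> e2 eV1 nc1; have eV := subset_trans eV1 sub_left.
have [cV|ncV] := boolP (cuts e V); last by left; apply/and3P.
right; move: (chord_left) (d2) (e2) nc1 cV eV1 => dl.
case/card2P=> a [b [ab Ed]] /card2P[u [v [uv Ee]]]; subst d e.
move=> /cutsP nc1 /cutsP[x [y [xV yV ex ey]]] /subsetP eV1.
have := eV1 u; have := eV1 v; rewrite !inE !eqxx orbT !out2 //.
move=> /(_ isT)/andP[_ hv] /(_ isT)/andP[_ hu].
have xl : x \in left_part [set a; b] V.
  by rewrite inE xV out2 //; move: ex; rewrite inn2 //; lia.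
have na z : z \in left_part [set a; b] V -> ~~ out [set u; v] z.
  by move=> zl; apply/negP=> ez; apply: nc1; exists x, z.
have al : ~~ out [set u; v] a by apply/na/(subsetP dl); rewrite !inE eqxx.
have bl : ~~ out [set u; v] b.
  by apply/na/(subsetP dl); rewrite !inE eqxx orbT.
rewrite !out2 // in al bl.
by congr [set _; _]; apply: val_inj => /=; lia.
Qed.

Lemma edge_right e : edge (right_part d V) e -> edge V e \/ e = d.
Proof.
case/and3P=> e2 eV1 nc1; have eV := subset_trans eV1 sub_right.
have [cV|ncV] := boolP (cuts e V); last by left; apply/and3P.
right; move: (chord_right) (d2) (e2) nc1 cV eV1 => dl.
case/card2P=> a [b [ab Ed]] /card2P[u [v [uv Ee]]]; subst d e.
move=> /cutsP nc1 /cutsP[x [y [xV yV ex ey]]] /subsetP eV1.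
have := eV1 u; have := eV1 v; rewrite !inE !eqxx orbT !inn2 //.
move=> /(_ isT)/andP[_ hv] /(_ isT)/andP[_ hu].
have al : a \in right_part [set a; b] V by apply/(subsetP dl); rewrite !inE eqxx.
have bl : b \in right_part [set a; b] V.
  by apply/(subsetP dl); rewrite !inE eqxx orbT.
rewrite inn2 // in ex; rewrite out2 // in ey.
have ni : ~ (inn [set u; v] a /\ out [set u; v] b).
  by case=> ? ?; apply: nc1; exists a, b.
have ni' : ~ (inn [set u; v] b /\ out [set u; v] a).
  by case=> ? ?; apply: nc1; exists b, a.
rewrite !inn2 // !out2 // in ni ni'.
have nx : x \in right_part [set a; b] V -> ~ (out [set u; v] a || out [set u; v] b).
  by move=> xr /orP[] h; apply: nc1; [exists x, a|exists x, b]; split=> //;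
    rewrite inn2.
have ny : y \in right_part [set a; b] V -> ~ (inn [set u; v] a || inn [set u; v] b).
  by move=> xr /orP[] h; apply: nc1; [exists a, y|exists b, y]; split=> //;
    rewrite out2.
have nxy : ~ (x \in right_part [set a; b] V /\ y \in right_part [set a; b] V).
  by case=> ? ?; apply: nc1; exists x, y; split=> //; rewrite ?inn2 ?out2.
rewrite !inE xV yV !inn2 // !out2 // in nx ny nxy.
by congr [set _; _]; apply: val_inj => /=; lia.
Qed.

Lemma cpiece_left : cpiece (d |: D) (left_part d V).
Proof.
have /cpieceP[_ sV cV] := pV; apply/cpieceP; split; first exact: card_left.
  move=> e /edge_left[/sV[eT|eD]|->]; [by left|right|right]; rewrite in_setU1.
    by rewrite eD orbT.
  by rewrite eqxx.
move=> e; rewrite in_setU1 => /orP[/eqP->|eD].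
  by apply/cutsP=> -[x [y [_]]]; rewrite inE => /andP[_ /negPf->].
by apply: contra (cV _ eD); apply/cuts_mono/sub_left.
Qed.

Lemma cpiece_right : cpiece (d |: D) (right_part d V).
Proof.
have /cpieceP[_ sV cV] := pV; apply/cpieceP; split; first exact: card_right.
  move=> e /edge_right[/sV[eT|eD]|->]; [by left|right|right]; rewrite in_setU1.
    by rewrite eD orbT.
  by rewrite eqxx.
move=> e; rewrite in_setU1 => /orP[/eqP->|eD].
  by apply/cutsP=> -[x [y []]]; rewrite inE => /andP[_ /negPf->].
by apply: contra (cV _ eD); apply/cuts_mono/sub_right.
Qed.

(** A new piece without [d] among its vertices does not have [d] as an edge, so it was a piece
    before. A new piece containing [d] and different from both parts would be separated from each of
    them by [d] itself, leaving it no vertex off [d]. *)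
Lemma cpieces_split : cpieces (d |: D) =
  left_part d V |: (right_part d V |: cpieces D :\ V).
Proof.
apply/setP=> W; rewrite !inE; apply/idP/idP; last first.
  case/or3P=> [/eqP->|/eqP->|/andP[WV pW]].
  - exact: cpiece_left.
  - exact: cpiece_right.
  have /cpieceP[W3 sW cW] := pW; apply/cpieceP; split=> // [e /sW[eT|eD]|e].
  - by left.
  - by right; rewrite inE eD orbT.
  rewrite in_setU1 => /orP[/eqP->|]; last exact: cW.
  rewrite eq_sym in WV; have [f [fD f2 sep]] := cpieces_wsep pV pW WV.
  exact: wsep_cuts sep.
move=> pW; have /cpieceP[W3 sW cW] := pW.
have ncdW : ~~ cuts d W by apply: cW; rewrite setU11.
have [dW|dW] := boolP (d \subset W); last first.
  rewrite orbA orbC; apply/orP; left; apply/andP; split.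
    by apply: contraNneq dW => ->.
  apply/cpieceP; split=> // e; last by move=> eD; apply: cW; rewrite inE eD orbT.
  move=> eW; case: (sW _ eW); first by left.
  rewrite in_setU1 => /orP[/eqP Ee|]; last by right.
  by case/and3P: eW => _; rewrite Ee (negPf dW).
have key U : cpiece (d |: D) U -> d \subset U -> W != U -> wsep d W U.
  move=> pU dU WU; have [e [eD e2 sep]] := cpieces_wsep pW pU WU.
  rewrite (@eq_subset2 d e) //; apply: subset_trans (wsep_meet sep).
  by rewrite subsetI dW.
apply/or3P; have [|nl] := eqVneq W (left_part d V); first by constructor 1.
have [|nr] := eqVneq W (right_part d V); first by constructor 2.
case/negP: (subset_card3 d2 W3).
have [x xl dx] := left_part_inn; have [y yr dy] := right_part_out.
have /wsepP[[h _]|[_ /(_ _ xl)]] := key _ cpiece_left chord_left nl; last first.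
  by rewrite dx.
have /wsepP[[_ /(_ _ yr)]|[h' _]] := key _ cpiece_right chord_right nr.
  by rewrite dy.
exact: no_inn_out_sub.
Qed.

Lemma left_neq_right : left_part d V != right_part d V.
Proof.
have [x xl dx] := left_part_inn; apply: contraTneq xl => ->.
by rewrite inE dx andbF.
Qed.

(** Distinct pieces meet inside a chord, hence in at most two vertices. *)
Lemma sub_not_cpiece W : W \subset V -> 3 <= #|W| -> W != V -> W \notin cpieces D.
Proof.
move=> WV W3 nWV; rewrite inE; apply: contraL W3 => pW.
have [e [_ /eqP e2 /wsep_meet]] := cpieces_wsep pW pV nWV.
by rewrite (setIidPl WV) => /subset_leq_card; rewrite e2 -leqNgt.
Qed.

Lemma left_notin : left_part d V \notin cpieces D.
Proof.
apply: sub_not_cpiece sub_left card_left _.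
have [x xr dx] := right_part_out; apply: contraTneq xr => <-.
by rewrite !inE dx !andbF.
Qed.

Lemma right_notin : right_part d V \notin cpieces D.
Proof.
apply: sub_not_cpiece sub_right card_right _.
have [x xr dx] := left_part_inn; apply: contraTneq xr => <-.
by rewrite !inE dx !andbF.
Qed.

(** With [F] constant this counts pieces; with [F] the indicator of a given size it tracks the type.
    The term [F V] is added on the left to avoid subtraction in [nat]. *)
Lemma sum_cpieces_split (F : {set 'I_N} -> nat) :
  \sum_(W in cpieces (d |: D)) F W + F V =
  \sum_(W in cpieces D) F W + (F (left_part d V) + F (right_part d V)).
Proof.
rewrite cpieces_split big_setU1 /=; last first.
  by rewrite in_setU1 in_setD1 (negPf left_neq_right) (negPf left_notin) andbF.
rewrite big_setU1 /=; last by rewrite in_setD1 (negPf right_notin) andbF.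
rewrite [in RHS](big_setD1 V) ?inE //=.
by rewrite [RHS]addnC [F V + _]addnC !addnA.
Qed.

Lemma noncrossing_chord : noncrossing D -> noncrossing (d |: D).
Proof.
case/noncrossingP=> dD cD; have /cpieceP[_ _ cV] := pV.
have dd : diag d by rewrite /diag d2; apply: cuts_mono cdV; apply: subsetT.
have ced e : e \in D -> ~~ cuts e d by move/cV; apply/contra/cuts_mono.
apply/noncrossingP; split=> [e|e f]; rewrite !in_setU1.
  by case/orP=> [/eqP->|/dD].
case/orP=> [/eqP->|eD] /orP[/eqP->|fD].
- by rewrite cuts_id.
- by rewrite cuts_sym ?ced //; case/andP: (dD _ fD).
- exact: ced.
- exact: cD.
Qed.

End Split.

Lemma cpieces_set0 : 3 <= N -> cpieces set0 = [set setT].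
Proof.
move=> N3; have pT : cpiece set0 setT.
  apply/cpieceP; split=> [|d dT|d]; rewrite ?inE //; last by left.
  by rewrite cardsT card_ord.
apply/setP=> V; rewrite in_set1 inE; apply/idP/eqP=> [pV|->//].
by apply/eqP/contraT=> /(cpieces_wsep pV pT)[e []]; rewrite inE.
Qed.

(** Induction on [D]: after removing a diagonal [e], both [d] and [e] lie in pieces. If these
    differ, the piece of [d] survives the cut along [e]; if they agree, [d] does not cross [e] and
    fits into one of the two parts. *)
Lemma cpiece_chord_ex D d : 3 <= N -> noncrossing (d |: D) -> d \notin D ->
  exists2 V, V \in cpieces D & (d \subset V) && cuts d V.
Proof.
move=> N3; have [m mD] := ubnP #|D|; elim: m D d mD => // m IH D d mD ncd dD.
have dd : diag d by case/noncrossingP: ncd => + _; apply; rewrite setU11.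
have /andP[d2 cdT] := dd.
(* Containment suffices: a chord of [V] that does not cut [V] is an edge of it, hence a side of the
   polygon or a member of [D], and [d] is neither. *)
suff [V pV dV] : exists2 V, V \in cpieces D & d \subset V.
  exists V => //; rewrite dV; apply: contraT => ncV.
  move: pV; rewrite inE => /cpieceP[_ sV _].
  case: (sV d); rewrite ?(negPf dD) // /edge ?d2 ?dV //.
  by rewrite cdT subsetT.
have [->|[e eD]] := set_0Vmem D.
  by exists setT; rewrite ?cpieces_set0 ?inE ?subsetT.
pose D0 := D :\ e; have ED : D = e |: D0 by rewrite setD1K.
have mD0 : #|D0| < m by move: mD; rewrite (cardsD1 e) eD.
have eD0 : e \notin D0 by rewrite !inE eqxx.
have dD0 : d \notin D0 by rewrite !inE (negPf dD) andbF.
have nce : noncrossing (e |: D0).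
  by rewrite -ED; apply: noncrossing_sub ncd; apply: subsetUr.
have ncd0 : noncrossing (d |: D0).
  by apply: noncrossing_sub ncd; rewrite ED; apply/setUS/subsetUr.
have [V0 pV0 /andP[eV0 ceV0]] := IH _ _ mD0 nce eD0.
have [V pV /andP[dV cdV]] := IH _ _ mD0 ncd0 dD0.
have /noncrossingP[dnc cnc] := ncd.
have e2 : #|e| == 2 by have /andP[] := dnc _ (setU1r d eD).
rewrite ED (cpieces_split _ e2 eV0 ceV0); last by rewrite -in_set.
have [EV|nV] := eqVneq V V0; last first.
  by exists V => //; rewrite !in_setU1 in_setD1 nV pV !orbT.
have /cutsP ned : ~~ cuts e d by apply: cnc; rewrite !inE ?eqxx // eD orbT.
have [/existsP[x /andP[xd ex]]|/existsPn ni] := boolP [exists x in d, inn e x].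
  exists (left_part e V0); first by rewrite setU11.
  apply/subsetP=> y yd; rewrite inE -EV (subsetP dV) //=.
  by apply/negP=> ey; apply: ned; exists x, y.
exists (right_part e V0); first by rewrite !in_setU1 eqxx orbT.
by apply/subsetP=> y yd; rewrite inE -EV (subsetP dV) //=; have := ni y; rewrite yd.
Qed.

Lemma card_cpieces D : 3 <= N -> noncrossing D -> #|cpieces D| = #|D|.+1.
Proof.
move=> N3; have [m mD] := ubnP #|D|; elim: m D mD => // m IH D mD nc.
have [->|[d dD]] := set_0Vmem D; first by rewrite cpieces_set0 // cards1 cards0.
pose D0 := D :\ d; have ED : D = d |: D0 by rewrite setD1K.
have dD0 : d \notin D0 by rewrite !inE eqxx.
have cD : #|D| = #|D0|.+1 by rewrite ED cardsU1 dD0.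
have nc0 : noncrossing D0 by apply: noncrossing_sub nc; apply: subsetDl.
have [|V + /andP[dV cdV]] := cpiece_chord_ex N3 _ dD0; first by rewrite -ED.
rewrite inE => pV.
have d2 : #|d| == 2 by case/noncrossingP: nc => /(_ _ dD)/andP[].
have := sum_cpieces_split pV d2 dV cdV (fun=> 1).
have := IH D0; rewrite -ED !sum1_card cD => ->//; lia.
Qed.

End Pieces.

(** * Sides and chords in the vertex enumeration *)

Section Enumeration.

Variable N : nat.
Implicit Types (a b x y z : 'I_N) (c d e V W : {set 'I_N}).

(** An increasing indexing of [V] by natural numbers reduces statements about [next] and chords to
    linear arithmetic on indices. *)
Lemma set_enumeration V : 0 < #|V| -> exists s : nat -> 'I_N,
  [/\ forall i, i < #|V| -> s i \in V,
      forall i j, i < j -> j < #|V| -> s i < s j,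
      forall z, z \in V -> exists2 i, i < #|V| & z = s i
    & forall i, i < #|V| ->
        next (enum V) (s i) = s (if i.+1 == #|V| then 0 else i.+1)].
Proof.
case/card_gt0P=> x0 _; exists (nth x0 (enum V)); rewrite cardE.
have srt : sorted (relpre val ltn) (enum V).
  rewrite -sorted_map.
  rewrite (subseq_sorted ltn_trans _ (iota_ltn_sorted 0 N)) //.
  rewrite -val_enum_ord; apply: map_subseq.
  by rewrite {1}/enum_mem; apply: subseq_trans (filter_subseq _ _) _; rewrite enumT.
split=> [i iV|i j ij jV|z zV|i iV].
- by rewrite -mem_enum mem_nth.
- apply: (sorted_ltn_nth _ x0 srt) => //; last exact: ltn_trans jV.
  by move=> ? ? ?; apply: ltn_trans.
- by exists (index z (enum V)); rewrite ?nth_index ?index_mem ?mem_enum.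
rewrite next_nth mem_nth // index_uniq ?enum_uniq //.
case: (enum V) iV => // y p /= iV; rewrite eqSS.
(* The default in [next_nth] is the head [y], so running past the end of the tail gives the
   wrap-around to index 0. *)
case: eqP => [->|ne] /=; first by rewrite nth_default.
by apply: set_nth_default; lia.
Qed.

Lemma set2_inj (a b a' b' : 'I_N) : a < b -> a' < b' ->
  [set a; b] = [set a'; b'] -> a = a' /\ b = b'.
Proof.
move=> ab ab' /setP E.
have := E a; have := E b; have := E a'; have := E b'.
rewrite !inE !eqxx !orbT !ord_eqE /=.
by split; apply: val_inj => /=; lia.
Qed.

Lemma sidesE V d : 2 <= #|V| -> (d \in sides V) = edge V d.
Proof.
move=> V2; have [|s [sV slt sE snx]] := @set_enumeration V; first by lia.
have sinj i j : i < #|V| -> j < #|V| -> s i < s j -> i < j.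
  move=> iV jV; case: (ltngtP i j) => [//|ji|->]; last by rewrite ltnn.
  by have := slt _ _ ji iV; lia.
apply/imsetP/idP => [[a aV ->]|].
  have [i iV ->] := sE _ aV; rewrite snx //.
  have [E|nE] := eqVneq i.+1 #|V|.
    have lt0 : s 0 < s i by apply: slt => //; lia.
    rewrite setUC; apply/and3P; split.
    - by apply/card2P; exists (s 0), (s i).
    - by rewrite subUset !sub1set !sV //; lia.
    apply/cutsP=> -[x [y [_ yV _]]]; have [j jV ->] := sE _ yV.
    rewrite out2 // => /orP[] /sinj; first by move=> /(_ jV) h; have := h (ltnW V2).
    by move/(_ iV jV); lia.
  have lti : s i < s i.+1 by apply: slt => //; lia.
  apply/and3P; split.
  - by apply/card2P; exists (s i), (s i.+1).
  - by rewrite subUset !sub1set !sV //; lia.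
  apply/cutsP=> -[x [y [xV _ + _]]]; have [j jV ->] := sE _ xV.
  rewrite inn2 // => /andP[] /sinj h1 /sinj h2; have := h1 iV jV.
  have i1 : i.+1 < #|V| by lia.
  by have := h2 jV i1; lia.
case/and3P=> /card2P[a [b [ab ->]]]; rewrite subUset !sub1set.
case/andP=> aV bV /cutsP nc.
have [i iV Ea] := sE _ aV; have [j jV Eb] := sE _ bV; subst a b.
have ij := sinj _ _ iV jV ab.
have [Ej|nj] := eqVneq j i.+1.
  by exists (s i); rewrite // snx // Ej; case: eqP => //; lia.
(* Unless the indices are the first and the last, [s i.+1] lies strictly inside the chord and
   [s j.+1] or [s 0] strictly outside, so the chord would cut [V]. *)
have [E0|n0] := eqVneq i 0; have [El|nl] := eqVneq j.+1 #|V|.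
- by exists (s j); rewrite // snx // El eqxx E0 setUC.
all: have i1 : inn [set s i; s j] (s i.+1) by rewrite inn2 // !slt //; lia.
all: case: nc.
- exists (s i.+1), (s j.+1); split; rewrite ?sV //; try lia.
  by rewrite out2 // (slt j) ?orbT //; lia.
all: exists (s i.+1), (s 0); split; rewrite ?sV //; try lia.
all: by rewrite out2 // (slt 0) //; lia.
Qed.

(** If two vertices gave the same side, each would be the successor of the other, a cycle of length
    two. *)
Lemma card_sides V : 3 <= #|V| -> #|sides V| = #|V|.
Proof.
move=> V3; have [|s [sV slt sE snx]] := @set_enumeration V; first by lia.
have sinj i j : i < #|V| -> j < #|V| -> s i = s j -> i = j.
  move=> iV jV; case: (ltngtP i j) => [ij|ji|//] E.
    by have := slt _ _ ij jV; rewrite E ltnn.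
  by have := slt _ _ ji iV; rewrite E ltnn.
apply: card_in_imset => a b aV bV.
have [i iV ->] := sE _ aV; have [j jV ->] := sE _ bV; rewrite !snx // => E.
apply/eqP; apply: contraT => nij.
have : s i \in [set s j; s (if j.+1 == #|V| then 0 else j.+1)] by rewrite -E !inE eqxx.
have : s j \in [set s i; s (if i.+1 == #|V| then 0 else i.+1)] by rewrite E !inE eqxx.
rewrite !inE (negPf nij) eq_sym (negPf nij) /=.
by case: (i.+1 =P #|V|) => ?; case: (j.+1 =P #|V|) => ? /eqP/sinj h1 /eqP/sinj h2;
  lia.
Qed.

(** Such a chord joins [s i] to [s (i + x.-1)], and the second index is in range exactly when
    [i < y.-1]. *)
Lemma card_chords V (x y : nat) : 3 <= x -> 3 <= y -> x + y = #|V| + 2 ->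
  #|[set d : {set 'I_N} |
      [&& #|d| == 2, d \subset V, cuts d V & #|left_part d V| == x]]| = y.-1.
Proof.
move=> x3 y3 xy.
have [|s [sV slt sE _]] := @set_enumeration V; first by lia.
have sinj i j : i < #|V| -> j < #|V| -> s i < s j -> i < j.
  move=> iV jV; case: (ltngtP i j) => [//|ji|->]; last by rewrite ltnn.
  by have := slt _ _ ji iV; lia.
have cl i j : i < j -> j < #|V| -> #|left_part [set s i; s j] V| = (j - i).+1.
  move=> ij jV; rewrite -[RHS]card_ord -cardsT.
  rewrite -(card_imset (f := fun t : 'I_(j - i).+1 => s (i + t))); last first.
    move=> t u E; apply/val_inj/eqP; rewrite eqn_leq /=; apply: contraT.
    have tl := ltn_ord t; have ul := ltn_ord u.
    rewrite negb_and -!ltnNge => /orP[] h.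
      have : s (i + u) < s (i + t) by apply: slt; lia.
      by rewrite E ltnn.
    have : s (i + t) < s (i + u) by apply: slt; lia.
    by rewrite E ltnn.
  congr #|pred_of_set _|; apply/setP=> z; apply/idP/imsetP.
    rewrite inE out2 ?slt // negb_or -!leqNgt => /andP[zV /andP[h1 h2]].
    have [t tV Ez] := sE _ zV; subst z.
    have it : i <= t by rewrite leqNgt; apply/negP=> /slt/(_ (ltn_trans ij jV)); lia.
    have tj : t <= j by rewrite leqNgt; apply/negP=> /slt/(_ tV); lia.
    have tlt : t - i < (j - i).+1 by lia.
    by exists (Ordinal tlt); rewrite //= subnKC.
  case=> t _ ->; have tl := ltn_ord t.
  have h1 : s i <= s (i + t).
    by case: (posnP t) => [->|t0]; [rewrite addn0|apply/ltnW/slt; lia].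
  have h2 : s (i + t) <= s j.
    case: (ltngtP (i + t) j) => [lt|gt|->] //; last by lia.
    exact/ltnW/slt.
  have lij := slt _ _ ij jV; have itV : i + t < #|V| by lia.
  by rewrite inE (sV _ itV) out2 //; lia.
have iV i : i < y.-1 -> i < i + x.-1 < #|V| by lia.
pose f (i : 'I_y.-1) := [set s i; s (i + x.-1)].
have flt (i : 'I_y.-1) : s i < s (i + x.-1).
  by have /andP[] := iV _ (ltn_ord i); apply: slt.
rewrite -[RHS]card_ord -cardsT -(card_imset (f := f)); last first.
  move=> i j /(set2_inj (flt i) (flt j))[E _].
  have /andP[li ui] := iV _ (ltn_ord i); have /andP[lj uj] := iV _ (ltn_ord j).
  apply/val_inj; case: (ltngtP (val i) (val j)) => // h.
    by have := slt _ _ h (ltn_trans lj uj); rewrite E ltnn.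
  by have := slt _ _ h (ltn_trans li ui); rewrite E ltnn.
congr #|pred_of_set _|; apply/setP=> d; rewrite inE; apply/idP/imsetP.
  case/and4P=> /card2P[a [b [ab ->]]]; rewrite subUset !sub1set => /andP[aV bV] cd.
  have [i il Ea] := sE _ aV; have [j jl Eb] := sE _ bV; subst a b.
  have ij := sinj _ _ il jl ab; rewrite cl // => /eqP Ex.
  have iy : i < y.-1 by lia.
  by exists (Ordinal iy); rewrite // /f /=; congr [set _; s _]; lia.
case=> i _ ->; have /andP[h1 h2] := iV _ (ltn_ord i).
have d2 : #|f i| == 2 by apply/card2P; exists (s i), (s (i + x.-1)).
have dV : f i \subset V by rewrite subUset !sub1set !sV //; lia.
have lx : #|left_part (f i) V| = x by rewrite cl //; lia.
rewrite d2 dV lx eqxx andbT /=.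
have := card_parts d2 dV; rewrite lx => ry.
have /subsetPn[u] : ~~ (left_part (f i) V \subset f i).
  by apply: subset_card3 => //; rewrite lx.
have /subsetPn[v] : ~~ (right_part (f i) V \subset f i).
  by apply: subset_card3 => //; lia.
rewrite !inE => /andP[vV nv] vf /andP[uV nu] uf.
apply/cutsP; exists u, v; split=> //.
  by have := inn_or_out (f i) u; rewrite (negPf nu) !inE (negPf uf) orbF.
by have := inn_or_out (f i) v; rewrite (negPf nv) !inE (negPf vf).
Qed.

End Enumeration.

(** * Counting dissections by type *)

Section TypeArithmetic.

Implicit Types (f g t : nat -> nat) (M x y v w : nat).

Definition inc t x v : nat := t v + (v == x).
Definition dec t x v : nat := t v - (v == x).
(** The use of [dec t x] makes the case [x = y] require two pieces of that size. It also ensures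
    that the subtractions in [merge] are not truncated. *)
Definition splittable t x y : bool := (0 < t x) && (0 < dec t x y).
Definition merge t x y : nat -> nat := inc (dec (dec t x) y) (x + y - 2).

Lemma sum_dec t x M (F : nat -> nat) : 0 < t x -> x < M ->
  \sum_(v < M) t v * F v = F x + \sum_(v < M) dec t x v * F v.
Proof.
move=> tx xM; rewrite (bigD1 (Ordinal xM)) //= [in RHS](bigD1 (Ordinal xM)) //=.
rewrite /dec eqxx addnA -mulSn.
rewrite subn1 prednK //; congr (_ + _); apply: eq_bigr => v.
by rewrite -val_eqE /= => /negPf->; rewrite subn0.
Qed.

Lemma sum_inc t x M (F : nat -> nat) : x < M ->
  \sum_(v < M) inc t x v * F v = F x + \sum_(v < M) t v * F v.
Proof.
move=> xM; rewrite (@sum_dec (inc t x) x M) /inc ?eqxx ?addn1 //.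
by congr (_ + _); apply: eq_bigr => v _; rewrite /dec addnK.
Qed.

Lemma sum_dec1 t x M : 0 < t x -> x < M ->
  \sum_(v < M) t v = (\sum_(v < M) dec t x v).+1.
Proof.
move=> tx xM; have := @sum_dec t x M (fun=> 1) tx xM; rewrite add1n.
by under eq_bigr do rewrite muln1; under [in RHS]eq_bigr do rewrite muln1.
Qed.

Lemma sum_inc1 t x M : x < M ->
  \sum_(v < M) inc t x v = (\sum_(v < M) t v).+1.
Proof.
move=> xM; have := @sum_inc t x M (fun=> 1) xM; rewrite add1n.
by under eq_bigr do rewrite muln1; under [in RHS]eq_bigr do rewrite muln1.
Qed.

Lemma prod_fact_dec t x M : 0 < t x -> x < M ->
  \prod_(v < M) (t v)`! = t x * \prod_(v < M) (dec t x v)`!.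
Proof.
move=> tx xM; rewrite (bigD1 (Ordinal xM)) //= [in RHS](bigD1 (Ordinal xM)) //=.
rewrite /dec eqxx mulnA.
rewrite -{1}(prednK tx) factS prednK // subn1; congr (_ * _ * _).
by apply: eq_bigr => v; rewrite -val_eqE /= => /negPf->; rewrite subn0.
Qed.

(** Taking an [x] and a [y] out of [t] leaves the same type as taking the merged piece out of
    [merge t x y]; both sides are multiples of the factorial product of that common remainder. *)
Lemma prod_fact_merge t x y M : splittable t x y ->
  x < M -> y < M -> x + y - 2 < M ->
  merge t x y (x + y - 2) * \prod_(v < M) (t v)`! =
  t x * (t y - (y == x)) * \prod_(v < M) (merge t x y v)`!.
Proof.
case/andP=> tx ty xM yM wM.
rewrite (prod_fact_dec tx xM) (prod_fact_dec ty yM).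
rewrite (@prod_fact_dec (merge t x y) (x + y - 2)) //; last first.
  by rewrite /merge /inc eqxx addn1.
have -> : \prod_(v < M) (dec (merge t x y) (x + y - 2) v)`! =
          \prod_(v < M) (dec (dec t x) y v)`!.
  by apply: eq_bigr => v _; rewrite {1}/dec /merge /inc addnK.
by rewrite mulnCA -[RHS]mulnA; congr (_ * _); rewrite mulnCA.
Qed.

(** The sum runs over ordered pairs of distinct pieces weighted by the second one, and each second
    piece has one partner fewer than the total. *)
Lemma sum_ordered_pairs t M (F : nat -> nat) :
  \sum_(x < M) \sum_(y < M) F y * (t x * (t y - (y == x :> nat))) =
  (\sum_(v < M) t v).-1 * \sum_(v < M) t v * F v.
Proof.
rewrite exchange_big big_distrr /=; apply: eq_bigr => y _.
transitivity (\sum_(x < M) F y * t y * dec t y x).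
  apply: eq_bigr => x _; rewrite /dec eq_sym.
  by case: eqP => [->|_]; rewrite ?subn0 -!mulnA; congr (_ * _); rewrite mulnC.
rewrite -big_distrr /=; have [->|ty] := posnP (t y); first by rewrite !muln0 mul0n.
by rewrite (sum_dec1 ty (ltn_ord y)) /= mulnC [F y * _]mulnC.
Qed.

(** Here [g] is the type before a cut and [f] the type after it, related additively. The condition
    [0 < g w] records that the piece being cut is present. *)
Lemma merge_char f g t x y w M : x < M -> y < M -> w + 2 = x + y ->
  0 < g w ->
  (forall v, f v + (w == v) = g v + ((x == v) + (y == v))) ->
  [forall v : 'I_M, f v == t v] =
  splittable t x y && [forall v : 'I_M, g v == merge t x y v].
Proof.
move=> xM yM wE gw fg; have Ew : x + y - 2 = w by rewrite -wE addnK.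
have nb (b : bool) : (b : nat) <= 1 by case: b.
apply/forallP/andP => [ft|[/andP[]]].
  split; last apply/forallP=> v; rewrite /splittable /merge /inc /dec ?Ew.
    have /eqP fx := ft (Ordinal xM); have /eqP fy := ft (Ordinal yM).
    move: fx fy => /= <- <-; have := fg x; have := fg y; rewrite !eqxx.
    have := nb (w == x); have := nb (w == y).
    have h1 : (w == x) <= g x by case: eqP => // <-.
    have h2 : (w == y) <= g y by case: eqP => // <-.
    rewrite [y == x]eq_sym; lia.
  have /eqP <- := ft v; have := fg v; rewrite /= ![nat_of_ord v == _]eq_sym.
  have h : (w == v) <= g v by case: eqP => // <-.
  by move=> ?; lia.
rewrite /merge /inc /dec Ew => tx ty /forallP gt v.
have /eqP := gt v; have := fg v; rewrite /= ![nat_of_ord v == _]eq_sym.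
have h1 : (x == v) <= t v by case: eqP => // <-.
have h2 : (y == v) <= t v - (x == v).
  by case: (y =P v) => // <-; move: ty; rewrite eq_sym.
by move=> ? ?; lia.
Qed.

End TypeArithmetic.

(** * The recurrence obtained by deleting a diagonal, and its solution *)

Section Counting.

Variable N : nat.
Hypothesis N3 : 3 <= N.
Implicit Types (d V W : {set 'I_N}) (D : {set {set 'I_N}}) (t : nat -> nat).

Definition mult D v : nat := #|[set V in cpieces D | #|V| == v]|.

(** Sizes up to [N] suffice, since a piece has at most [N] vertices. *)
Definition of_type t D : bool :=
  noncrossing D && [forall v : 'I_N.+1, mult D v == t v].

Definition count_type t : nat := #|[set D | of_type t D]|.

Definition chord V d : bool := [&& #|d| == 2, d \subset V & cuts d V].

Lemma multE D v : mult D v = \sum_(V in cpieces D) (#|V| == v).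
Proof.
rewrite /mult -sum1dep_card big_mkcondr /=.
by apply: eq_bigr => V _; case: eqP.
Qed.

Lemma card_lt V : #|V| < N.+1.
Proof. by rewrite ltnS -[X in _ <= X]card_ord max_card. Qed.

Lemma sum_mult D : \sum_(v < N.+1) mult D v = #|cpieces D|.
Proof.
under eq_bigr do rewrite multE.
rewrite exchange_big /= -sum1_card.
apply: eq_bigr => V _; rewrite (bigD1 (Ordinal (card_lt V))) //= eqxx big1 ?addn0 //.
by move=> v; rewrite -val_eqE eq_sym /= => /negPf->.
Qed.

Lemma mult_gt0 D V : V \in cpieces D -> 0 < mult D #|V|.
Proof. by move=> pV; apply/card_gt0P; exists V; rewrite inE pV eqxx. Qed.

Lemma of_type_card t D k : of_type t D -> \sum_(v < N.+1) t v = k.+1 -> #|D| = k.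
Proof.
case/andP=> nc /forallP mt st.
have := card_cpieces N3 nc; rewrite -sum_mult.
by rewrite (eq_bigr (fun v : 'I_N.+1 => t v)) => [|v _]; [rewrite st => -[]|exact/eqP].
Qed.

Lemma of_type_split t D V d : noncrossing D -> V \in cpieces D -> chord V d ->
  of_type t (d |: D) =
  let x := #|left_part d V| in let y := #|right_part d V| in
  splittable t x y && of_type (merge t x y) D.
Proof.
move=> nc pV /and3P[d2 dV cdV] /=; rewrite inE in pV.
rewrite /of_type (noncrossing_chord pV d2 dV cdV) // nc /=.
apply: (@merge_char _ _ _ _ _ #|V|); rewrite ?card_lt //.
- by rewrite card_parts.
- by rewrite mult_gt0 // inE.
by move=> v; rewrite !multE; apply: (sum_cpieces_split pV d2 dV cdV).
Qed.

(** Once the two part sizes are fixed, the type condition no longer depends on [d] by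
    [of_type_split]; the remaining chords are those of [card_chords]. *)
Lemma card_typed_chords t D V x y : (forall v, v < 3 -> t v = 0) ->
  noncrossing D -> V \in cpieces D ->
  #|[set d | [&& chord V d, of_type t (d |: D), #|left_part d V| == x
                & #|right_part d V| == y]]| =
  (splittable t x y && of_type (merge t x y) D) * (#|V| == x + y - 2) * y.-1.
Proof.
move=> t3 nc pV; case: andP => [[ok ty]|nok]; last first.
  rewrite /= !mul0n; apply/eqP; rewrite cards_eq0; apply/eqP/setP=> d.
  rewrite !inE; apply/negP=> /and4P[cd + /eqP lx /eqP ry].
  by rewrite (of_type_split _ nc pV cd) /= lx ry => /andP.
rewrite mul1n; case/andP: (ok) => tx ty0.
have x3 : 3 <= x by rewrite leqNgt; apply: contraTN tx => /t3->.
have y3 : 3 <= y.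
  by rewrite leqNgt; apply: contraTN ty0 => /t3; rewrite /dec => ->.
have [EV|nV] := eqVneq; last first.
  rewrite mul0n; apply/eqP; rewrite cards_eq0; apply/eqP/setP=> d.
  rewrite !inE; apply/negP=> /and4P[/and3P[d2 dV _] _ /eqP lx /eqP ry].
  by move: nV; rewrite -lx -ry card_parts // addnK eqxx.
rewrite mul1n -(@card_chords N V x y) //; last by lia.
apply: eq_card => d; rewrite !inE.
apply/and4P/and4P => [[/and3P[-> -> ->] _ -> _]|[d2 dV cV lx]] //.
have ry : #|right_part d V| == y.
  by have := card_parts d2 dV; rewrite (eqP lx) EV; lia.
have cd : chord V d by apply/and3P.
split=> //; rewrite (of_type_split _ nc pV cd) /= (eqP lx) (eqP ry).
by rewrite ok.
Qed.

Lemma card_extensions t D : (forall v, v < 3 -> t v = 0) ->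
  #|[set d | (d \notin D) && of_type t (d |: D)]| =
  \sum_(x < N.+1) \sum_(y < N.+1)
    (splittable t x y && of_type (merge t x y) D) * mult D (x + y - 2) * y.-1.
Proof.
move=> t3; have [nc|nnc] := boolP (noncrossing D); last first.
  rewrite big1 => [|x _]; last first.
    by rewrite big1 // => y _; rewrite /of_type (negPf nnc) andbF mul0n.
  apply/eqP; rewrite cards_eq0; apply/eqP/setP=> d; rewrite !inE.
  apply: contraNF nnc => /andP[_ /andP[+ _]]; by apply: noncrossing_sub; apply: subsetUr.
(* The piece containing [d]. The default [setT] arises only if no piece contains [d], which
   [cpiece_chord_ex] excludes for the diagonals being counted. *)
pose host d := odflt setT [pick V in cpieces D | d \subset V].
have hostP d V : V \in cpieces D -> d \notin D -> #|d| == 2 -> d \subset V ->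
    host d = V.
  move=> pV dD d2 dV; rewrite /host; case: pickP => [W /andP[pW dW]|/(_ V)].
    by move: pV pW; rewrite !inE => pV pW; apply: (cpiece_chord_uniq pW pV d2).
  by rewrite pV dV.
rewrite -sum1dep_card (partition_big host (mem (cpieces D))) /=; last first.
  move=> d /andP[dD /andP[ncd _]].
  have [V pV /andP[dV cV]] := cpiece_chord_ex N3 ncd dD.
  rewrite (hostP _ _ pV dD _ dV) //.
  by case/noncrossingP: ncd => /(_ _ (setU11 _ _))/andP[].
transitivity (\sum_(V in cpieces D) \sum_(x < N.+1) \sum_(y < N.+1)
  (splittable t x y && of_type (merge t x y) D) * (#|V| == x + y - 2) * y.-1).
  apply: eq_bigr => V pV.
  rewrite (partition_big (fun d => Ordinal (card_lt (left_part d V))) xpredT) //=.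
  apply: eq_bigr => x _.
  rewrite (partition_big (fun d => Ordinal (card_lt (right_part d V))) xpredT) //=.
  apply: eq_bigr => y _; rewrite -card_typed_chords // -sum1dep_card.
  apply: eq_bigl => d; rewrite -![Ordinal _ == _]val_eqE /=.
  apply/idP/idP.
    case/andP=> /andP[/andP[/andP[dD ty] /eqP hd] ->] ->; rewrite ty !andbT.
    have /andP[ncd _] := ty.
    have [W pW /andP[dW cW]] := cpiece_chord_ex N3 ncd dD.
    have d2 : #|d| == 2.
      by case/noncrossingP: ncd => /(_ _ (setU11 _ _))/andP[].
    by rewrite -hd (hostP _ _ pW dD d2 dW); apply/and3P.
  case/and4P=> /and3P[d2 dV cV] ty -> ->.
  have dD : d \notin D by move: pV; rewrite inE => /chord_notin; apply.
  by rewrite dD ty (hostP _ _ pV dD d2 dV) eqxx.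
rewrite exchange_big; apply: eq_bigr => x _ /=.
rewrite exchange_big; apply: eq_bigr => y _ /=.
by rewrite multE -big_distrl big_distrr.
Qed.

(** Pairs of a dissection and one of its diagonals correspond to pairs of a smaller set [D] and a
    [d] outside it, through [d |: D]; [card_extensions] counts the latter. *)
Lemma sum_card_of_type t : (forall v, v < 3 -> t v = 0) ->
  \sum_(D | of_type t D) #|D| =
  \sum_(x < N.+1) \sum_(y < N.+1 | splittable t x y)
    y.-1 * \sum_(D | of_type (merge t x y) D) mult D (x + y - 2).
Proof.
move=> t3; transitivity (\sum_(D : {set {set 'I_N}})
    #|[set d : {set 'I_N} | (d \notin D) && of_type t (d |: D)]|).
  under eq_bigr do rewrite -sum1_card.
  under [RHS]eq_bigr => D _ do rewrite -sum1dep_card.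
  rewrite (exchange_big_dep xpredT) //= [RHS](exchange_big_dep xpredT) //=.
  apply: eq_bigr => d _.
  rewrite (reindex_onto (fun D => d |: D) (fun D => D :\ d)) /=; last first.
    by move=> D /andP[_ dD]; rewrite setD1K.
  apply: eq_bigl => D; rewrite setU11 andbT andbC; congr (_ && _).
  have [dD|dD] := boolP (d \in D); last by rewrite setU1K ?eqxx.
  by apply/eqP=> /setP/(_ d); rewrite !inE eqxx dD.
under eq_bigr do rewrite card_extensions //.
rewrite exchange_big; apply: eq_bigr => x _ /=.
rewrite exchange_big [RHS]big_mkcond; apply: eq_bigr => y _ /=.
case: splittable; last by rewrite big1.
rewrite big_distrr [RHS]big_mkcond; apply: eq_bigr => D _ /=.
by case: of_type; rewrite // mul1n mulnC.
Qed.

Lemma mult_set0 v : mult set0 v = (v == N).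
Proof.
by rewrite multE cpieces_set0 // big_set1 cardsT card_ord eq_sym.
Qed.

(** Here [k] is the number of diagonals, so there are [k.+1] pieces. The weight [v.-1] is the factor
    produced by [card_chords]. *)
Lemma count_typeE n k t : N = n.+1 -> (forall v, v < 3 -> t v = 0) ->
  \sum_(v < N.+1) t v = k.+1 -> \sum_(v < N.+1) t v * v.-1 = n + k ->
  count_type t * (n`! * \prod_(v < N.+1) (t v)`!) = (n + k)`!.
Proof.
move=> EN; elim: k t => [|k IH] t t3 st wt.
  (* Without diagonals the weight condition forces the only piece to have [N] vertices, and the
     empty set is the only dissection. *)
  have [v0 tv0] : exists v0 : 'I_N.+1, 0 < t v0.
    apply/existsP; apply: contraT => /existsPn h.
    by move: st; rewrite big1 // => v _; have := h v; rewrite lt0n negbK => /eqP.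
  have := sum_dec1 tv0 (ltn_ord v0); rewrite st => -[] /esym/eqP.
  rewrite sum_nat_eq0 => /forallP h.
  have h0 (v : 'I_N.+1) : dec t v0 v = 0 by apply/eqP; apply: (h v).
  have := @sum_dec t v0 N.+1 predn tv0 (ltn_ord v0).
  rewrite wt addn0 big1 => [|v _]; last by rewrite h0.
  rewrite addn0 => En.
  have v03 : 3 <= v0 by rewrite leqNgt; apply: contraTN tv0 => /t3->.
  have EvN : v0 = N :> nat by lia.
  have tE (v : 'I_N.+1) : t v = (v == N :> nat).
    have := h0 v; rewrite /dec EvN; case: eqP => [E|_] /=; last by rewrite subn0.
    by rewrite E -EvN; lia.
  rewrite big1 => [|v _]; last by rewrite tE; case: eqP.
  rewrite muln1 -[RHS]mul1n; congr (_ * _).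
  rewrite /count_type -(cards1 (set0 : {set {set 'I_N}})).
  apply: eq_card => D; rewrite !inE; apply/idP/eqP => [ty|->].
    by apply/eqP; rewrite -cards_eq0 (of_type_card ty st).
  apply/andP; split; first by apply/noncrossingP; split=> [d|d e]; rewrite inE.
  by apply/forallP=> v; rewrite mult_set0 tE.
(* The factor [k.+1] is the number of diagonals of each dissection, so the left side becomes the
   double count. *)
apply/eqP; rewrite -(eqn_pmul2l (ltn0Sn k)) mulnA; apply/eqP.
have -> : k.+1 * count_type t = \sum_(D | of_type t D) #|D|.
  rewrite mulnC /count_type -sum1dep_card big_distrl /=; apply: eq_bigr => D ty.
  by rewrite mul1n (of_type_card ty st).
rewrite sum_card_of_type // big_distrl /=.
transitivity (\sum_(x < N.+1) \sum_(y < N.+1)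
    y.-1 * (t x * (t y - (y == x :> nat))) * (n + k)`!); last first.
  under eq_bigr do rewrite -big_distrl.
  by rewrite -big_distrl sum_ordered_pairs st wt /= -mulnA addnS factS.
apply: eq_bigr => x _; rewrite big_distrl big_mkcond; apply: eq_bigr => y _ /=.
have [ok|] := boolP (splittable t x y); last first.
  rewrite negb_and -!leqNgt !leqn0 /dec => /orP[]/eqP->; by rewrite ?muln0.
have /andP[tx ty] := ok.
have x3 : 3 <= x by rewrite leqNgt; apply: contraTN tx => /t3->.
have y3 : 3 <= y.
  by rewrite leqNgt; apply: contraTN ty => /t3; rewrite /dec => ->.
have s1 := sum_dec1 tx (ltn_ord x).
have s2 := sum_dec1 ty (ltn_ord y).
have w1 := @sum_dec t x N.+1 predn tx (ltn_ord x).
have w2 := @sum_dec (dec t x) y N.+1 predn ty (ltn_ord y).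
(* The [k] remaining pieces weigh at least [k] together, which leaves at most [n.+1] for
   [x.-1 + y.-1]; hence the merged piece has at most [N] vertices. *)
have le12 : \sum_(v < N.+1) dec (dec t x) y v <=
            \sum_(v < N.+1) dec (dec t x) y v * v.-1.
  apply: leq_sum => v _; case: (ltnP v 3) => [/t3|v3].
    by rewrite /dec => ->; rewrite mul0n.
  by rewrite leq_pmulr //; lia.
have wN : x + y - 2 < N.+1 by lia.
have s3 := sum_inc1 (dec (dec t x) y) wN.
have w3 := @sum_inc (dec (dec t x) y) _ N.+1 predn wN.
have -> : \sum_(D | of_type (merge t x y) D) mult D (x + y - 2) =
   merge t x y (x + y - 2) * count_type (merge t x y).
  rewrite mulnC /count_type -sum1dep_card big_distrl; apply: eq_bigr => D.
  by case/andP=> _ /forallP/(_ (Ordinal wN))/eqP/= ->; rewrite mul1n.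
rewrite -(IH (merge t x y)); first last.
- by rewrite /merge w3; lia.
- by rewrite /merge s3; lia.
- move=> v v3; rewrite /merge /inc /dec t3 //; have -> : v == x + y - 2 = false by lia.
  by [].
have pf := prod_fact_merge ok (ltn_ord x) (ltn_ord y) wN.
move: pf; set P := \prod_(v < _) _; set P' := \prod_(v < _) _ => pf.
rewrite -[LHS]mulnA -[RHS]mulnA; congr (_ * _).
by rewrite [n`! * P]mulnC mulnACA pf -[LHS]mulnA [P' * _]mulnC
  -[count_type _ * _ * _]mulnA.
Qed.

End Counting.

(** * Geometry of a convex polygon *)

Local Open Scope ring_scope.

Section Geometry.

Variables (R : realFieldType) (N : nat) (p : 'I_N -> 'rV[R]_2).
Hypothesis hp : convex_polygon p.
Implicit Types (a b x y : 'I_N) (d e V W : {set 'I_N}) (D : {set {set 'I_N}}).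

Let area a b x : R := orient (p a) (p b) (p x).

Lemma area_rot a b x : area a b x = area b x a.
Proof. by rewrite /area /orient; ring. Qed.

Lemma area_swap a b x : area a b x = - area a x b.
Proof. by rewrite /area /orient; ring. Qed.

Lemma area_inn a b x : (a < b)%N -> inn [set a; b] x -> area a b x < 0.
Proof.
by move=> ab; rewrite inn2 // => /andP[ax xb]; rewrite area_swap oppr_lt0 hp.
Qed.

Lemma area_out a b x : (a < b)%N -> out [set a; b] x -> 0 < area a b x.
Proof.
move=> ab; rewrite out2 // => /orP[xa|bx]; last exact: hp.
by rewrite area_rot area_rot hp.
Qed.

Lemma area_mem a b x : x \in [set a; b] -> area a b x = 0.
Proof. by rewrite !inE => /orP[]/eqP->; rewrite /area /orient; ring. Qed.

(** [orient] is affine in its last argument, so it commutes with combinations of total weight 1. *)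
Lemma orient_comb (u v : 'rV[R]_2) V (w : 'I_N -> R) : \sum_(i in V) w i = 1 ->
  orient u v (\sum_(i in V) w i *: p i) =
  \sum_(i in V) w i * orient u v (p i).
Proof.
move=> w1; rewrite /orient !summxE.
have E i : w i * ((v 0 0 - u 0 0) * (p i 0 1 - u 0 1) -
                  (v 0 1 - u 0 1) * (p i 0 0 - u 0 0)) =
  (v 0 0 - u 0 0) * (w i *: p i) 0 1 - (v 0 1 - u 0 1) * (w i *: p i) 0 0 +
  w i * ((v 0 1 - u 0 1) * u 0 0 - (v 0 0 - u 0 0) * u 0 1).
  by rewrite !mxE; ring.
rewrite [RHS](eq_bigr _ (fun i _ => E i)) big_split /= -mulr_suml w1 mul1r.
by rewrite big_split /= sumrN -!mulr_sumr; ring.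
Qed.

(** A common point has zero area relative to the line of [d]. As a positive combination over [V]
    this area is a sum of terms of one sign, at least one of them nonzero because [V] has a vertex
    off [d]. *)
Lemma not_cuts_not_meet d V : #|d| == 2%N -> ~~ (V \subset d) -> ~~ cuts d V ->
  ~ interiors_meet p d V.
Proof.
case/card2P=> a [b [ab ->]] /subsetPn[z zV zd] ncut.
case=> q [[u [u0 u1 qu]] [w [w0 w1 qw]]].
have : \sum_(i in V) w i * area a b i = 0.
  rewrite -orient_comb // -qw qu orient_comb // big1 // => i id.
  by rewrite [orient _ _ _](area_mem id) mulr0.
have [/existsP[x /andP[xV dx]]|/existsPn ni] :=
    boolP [exists x in V, inn [set a; b] x].
- have no y : y \in V -> ~~ out [set a; b] y.
    by move=> yV; apply: contra ncut => dy; apply/cutsP; exists x, y.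
  have le0 y : y \in V -> w y * area a b y <= 0.
    move=> yV; rewrite pmulr_rle0 ?w0 //; have := inn_or_out [set a; b] y.
    by case/or3P=> [/area_mem->|/(area_inn ab)/ltW|/(negP (no _ yV))].
  rewrite (bigD1 x) //=; apply/eqP; rewrite lt_eqF //.
  rewrite ltr_wnDr ?sumr_le0 // => [i /andP[iV _]|]; first exact: le0.
  by rewrite pmulr_rlt0 ?w0 // area_inn.
have no y : y \in V -> ~~ inn [set a; b] y by move=> yV; have := ni y; rewrite yV.
have ge0 y : y \in V -> 0 <= w y * area a b y.
  move=> yV; rewrite pmulr_rge0 ?w0 //; have := inn_or_out [set a; b] y.
  by case/or3P=> [/area_mem->|/(negP (no _ yV))|/(area_out ab)/ltW].
rewrite (bigD1 z) //=; apply/eqP; rewrite gt_eqF //.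
rewrite ltr_wpDr ?sumr_ge0 // => [i /andP[iV _]|]; first exact: ge0.
rewrite pmulr_rgt0 ?w0 // area_out //; have := inn_or_out [set a; b] z.
by rewrite (negPf zd) (negPf (no _ zV)).
Qed.

(** The affine dependency of four points of the plane. For [x] and [y] on opposite sides of [a b]
    all four coefficients are positive, and it exhibits the crossing point of the two segments. *)
Lemma cross_identity a b x y :
  area x b y *: p a + area a x y *: p b = area a b y *: p x + area a x b *: p y.
Proof.
have E j : j = 0 :> 'I_2 \/ j = 1 :> 'I_2.
  by case: j => [[|[|//]] lt]; [left|right]; apply: val_inj.
apply/rowP=> j; rewrite !mxE /area /orient.
by have [->|->] := E j; ring.
Qed.

Lemma sum_set2 (U : zmodType) a b (F : 'I_N -> U) : (a < b)%N ->
  \sum_(i in [set a; b]) F i = F a + F b.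
Proof.
move=> ab; rewrite big_setU1 ?big_set1 //= inE ord_eqE /=; lia.
Qed.

Lemma weights_meet d V (u w : 'I_N -> R) : (0 < #|V|)%N ->
  (forall i, i \in d -> 0 < u i) -> (forall i, i \in V -> 0 < w i) ->
  \sum_(i in d) u i = \sum_(i in V) w i ->
  \sum_(i in d) u i *: p i = \sum_(i in V) w i *: p i ->
  interiors_meet p d V.
Proof.
move=> /card_gt0P[z zV] u0 w0 uw upwp.
set S := \sum_(i in V) w i in uw.
have S0 : 0 < S.
  rewrite /S (bigD1 z) //= ltr_pwDl ?w0 ?sumr_ge0 // => i /andP[iV _].
  exact/ltW/w0.
exists (S^-1 *: \sum_(i in V) w i *: p i); split.
  exists (fun i => S^-1 * u i); split=> [i iV||].
  - by rewrite mulr_gt0 ?invr_gt0 ?u0.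
  - by rewrite -mulr_sumr uw mulVf ?gt_eqF.
  - by rewrite -upwp scaler_sumr; apply: eq_bigr => i _; rewrite scalerA.
exists (fun i => S^-1 * w i); split=> [i iV||].
- by rewrite mulr_gt0 ?invr_gt0 ?w0.
- by rewrite -mulr_sumr mulVf ?gt_eqF.
- by rewrite scaler_sumr; apply: eq_bigr => i _; rewrite scalerA.
Qed.

(** Adding up [cross_identity] over all [x] of [V] inside [d] and all [y] of [V] outside gives
    positive weights on [d] and on [V] with the same total and the same weighted sum; [weights_meet]
    normalizes them. *)
Lemma cuts_meet d V : #|d| == 2%N -> cuts d V -> interiors_meet p d V.
Proof.
case/card2P=> a [b [ab ->]] /cutsP[x0 [y0 [x0V y0V dx0 dy0]]].
pose P := [pred i | (i \in V) && inn [set a; b] i].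
pose Q := [pred i | (i \in V) && out [set a; b] i].
pose A := \sum_(y | Q y) area a b y; pose B := \sum_(x | P x) area a x b.
(* Endpoints of [d] that belong to [V] need a positive weight as well: [w] gives them 1, and [u]
   adds the same amount on the other side. *)
pose w i := if inn [set a; b] i then A else if out [set a; b] i then B else 1.
pose ua := \sum_(x | P x) \sum_(y | Q y) area x b y.
pose ub := \sum_(x | P x) \sum_(y | Q y) area a x y.
pose u i := (if i == a then ua else ub) + (i \in V)%:R.
have nab : (b == a) = false by rewrite ord_eqE /=; lia.
have area1 x : P x -> 0 < area a x b.
  by case/andP=> _; rewrite inn2 // => /andP[ax xb]; apply: hp.
have area2 y : Q y -> 0 < area a b y by case/andP=> _; apply: area_out.
have area3 x y : P x -> Q y -> 0 < area x b y /\ 0 < area a x y.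
  case/andP=> _; rewrite inn2 // => /andP[ax xb] /andP[_]; rewrite out2 //.
  case/orP=> h; first by rewrite [area x b y]area_rot [area b y x]area_rot
    [area a x y]area_rot [area x y a]area_rot; split; apply: hp => //; lia.
  by split; apply: hp => //; lia.
have Px0 : P x0 by rewrite /= x0V.
have Qy0 : Q y0 by rewrite /= y0V.
have pos (I : finType) (K : pred I) (F : I -> R) i0 : K i0 ->
    (forall i, K i -> 0 < F i) -> 0 < \sum_(i | K i) F i.
  move=> Ki F0; rewrite (bigD1 i0) //= ltr_pwDl ?F0 ?sumr_ge0 // => i /andP[? _].
  exact/ltW/F0.
have ua0 : 0 < ua.
  apply: (pos _ _ _ _ Px0) => x Px; apply: (pos _ _ _ _ Qy0) => y Qy.
  by have [] := area3 _ _ Px Qy.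
have ub0 : 0 < ub.
  apply: (pos _ _ _ _ Px0) => x Px; apply: (pos _ _ _ _ Qy0) => y Qy.
  by have [] := area3 _ _ Px Qy.
(* A general module serves twice: with [g] constant 1 it compares the total weights, with [g = p]
   the weighted points. *)
have key (U : lmodType R) (g : 'I_N -> U) :
    (forall x y, area x b y *: g a + area a x y *: g b =
                 area a b y *: g x + area a x b *: g y) ->
    \sum_(i in [set a; b]) u i *: g i = \sum_(i in V) w i *: g i.
  move=> cross; rewrite sum_set2 // /u eqxx nab.
  rewrite [RHS](bigID (inn [set a; b])) /=
    [X in _ = _ + X](bigID (out [set a; b])) /=.
  have -> : \sum_(i in V | inn [set a; b] i) w i *: g i =
      \sum_(x | P x) \sum_(y | Q y) area a b y *: g x.
    by apply: eq_bigr => x /andP[_ dx]; rewrite /w dx scaler_suml.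
  have -> : \sum_(i | (i \in V) && ~~ inn [set a; b] i &&
      out [set a; b] i) w i *: g i =
      \sum_(x | P x) \sum_(y | Q y) area a x b *: g y.
    rewrite exchange_big /=.
    rewrite (eq_bigl Q) => [|y]; last first.
      by rewrite /= /out; case: (inn _ y); rewrite ?andbF ?andbT.
    apply: eq_bigr => y /andP[_ dy]; rewrite /w dy.
    by case: ifP dy => [/inn_out/negPf->//|_ _]; rewrite scaler_suml.
  have -> : \sum_(i | (i \in V) && ~~ inn [set a; b] i &&
      ~~ out [set a; b] i) w i *: g i =
      (a \in V)%:R *: g a + (b \in V)%:R *: g b.
    rewrite -(@sum_set2 _ a b (fun i => (i \in V)%:R *: g i)) //.
    rewrite big_mkcond [RHS]big_mkcond; apply: eq_bigr => i _ /=.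
    rewrite /w; have [id|nid] := boolP (i \in [set a; b]).
      have -> : inn [set a; b] i = false by rewrite /inn id.
      by rewrite /out id /=; case: (i \in V); rewrite ?scale0r.
    have := inn_or_out [set a; b] i; rewrite (negPf nid) /=.
    by case: (inn _ i) => [|/= ->]; rewrite /= ?andbF.
  rewrite addrA -big_split /= !scalerDl addrACA; congr (_ + _).
  rewrite /ua /ub !scaler_suml -big_split; apply: eq_bigr => x _ /=.
  by rewrite !scaler_suml -!big_split; apply: eq_bigr => y _ /=; apply: cross.
apply: (@weights_meet _ _ u w).
- by apply/card_gt0P; exists x0.
- move=> i _; rewrite /u; case: eqP => _; exact: ltr_pwDl.
- move=> i iV; rewrite /w; case: ifP => [_|_]; first exact: (pos _ _ _ _ Qy0).
  by case: ifP => // _; apply: (pos _ _ _ _ Px0).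
- have scale1 (K : {set 'I_N}) (F : 'I_N -> R) :
      \sum_(i in K) F i = \sum_(i in K) F i *: (1 : R^o).
    by apply: eq_bigr => i _; rewrite [RHS]mulr1.
  rewrite [LHS]scale1 [RHS]scale1; apply: (key R^o (fun=> 1)) => x y.
  by rewrite /GRing.scale /= /area /orient; ring.
- exact/key/cross_identity.
Qed.

Lemma interiors_meetP d V : #|d| == 2%N -> ~~ (V \subset d) ->
  (~ interiors_meet p d V) <-> ~~ cuts d V.
Proof.
move=> d2 Vd; split=> [nm|]; last exact: not_cuts_not_meet.
by apply/negP=> /(cuts_meet d2).
Qed.

End Geometry.

(** * Dissections of the polygon *)

Section Bridge.

Variables (R : realFieldType) (N : nat) (p : 'I_N -> 'rV[R]_2).
Hypotheses (hp : convex_polygon p) (N3 : (3 <= N)%N).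
Implicit Types (d e V W : {set 'I_N}) (D : {set {set 'I_N}}).

Lemma sides_setT d : (d \in sides [set: 'I_N]) = edge setT d.
Proof. by rewrite sidesE // cardsT card_ord ltnW. Qed.

Lemma is_diagonalE d : is_diagonal d = diag d.
Proof.
rewrite /is_diagonal /diag sides_setT /edge subsetT /=.
by case: (#|d| == 2%N); rewrite //= negbK.
Qed.

Lemma is_dissectionE D : is_dissection p D <-> noncrossing D.
Proof.
have meetP d e : diag d -> diag e -> d != e ->
    ~ interiors_meet p d e <-> ~~ cuts d e.
  move=> /andP[d2 _] /andP[e2 _] de; apply: (interiors_meetP hp) => //.
  by apply: contra de => /(eq_subset2 e2 d2) ->.
split=> [[dD cD]|/noncrossingP[dD cD]].
  apply/noncrossingP; split=> [d /dD|d e dd de]; first by rewrite is_diagonalE.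
  (* [is_dissection] compares distinct diagonals only; [noncrossing] also covers [d = e], where
     [cuts] is false. *)
  have [->|nde] := eqVneq d e; first by rewrite cuts_id.
  by apply/meetP; rewrite -?is_diagonalE ?dD //; apply: cD.
split=> [d /dD|d e dd de nde]; first by rewrite is_diagonalE.
by apply/meetP; rewrite ?dD // cD.
Qed.

Lemma is_pieceE D V : noncrossing D -> is_piece p D V <-> cpiece D V.
Proof.
case/noncrossingP=> dD _.
have meetP d : d \in D -> (3 <= #|V|)%N -> ~ interiors_meet p d V <-> ~~ cuts d V.
  move=> /dD/andP[d2 _] V3; apply: (interiors_meetP hp) => //.
  exact: subset_card3.
split=> [[V3 /subsetP sV cV]|/cpieceP[V3 sV cV]].
  apply/cpieceP; split=> // d; last by move=> dd; apply/meetP => //; apply: cV.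
  rewrite -sidesE 1?ltnW // => /sV; rewrite inE sides_setT.
  by case/orP; [left|right].
split=> // [|d dd]; last by apply/meetP => //; apply: cV.
apply/subsetP=> d; rewrite sidesE 1?ltnW // => /sV dV.
by rewrite inE sides_setT; apply/orP.
Qed.

Lemma piecesE D : noncrossing D -> pieces p D = cpieces D.
Proof.
by move=> nc; apply/setP=> V; rewrite !inE; apply/asboolP/idP; apply is_pieceE.
Qed.

Lemma multE_sides D v : noncrossing D ->
  #|[set V in pieces p D | #|sides V| == v]| = mult D v.
Proof.
move=> nc; rewrite piecesE //; apply: eq_card => V; rewrite !inE.
by apply: andb_id2l => /cpieceP[V3 _ _]; rewrite card_sides.
Qed.

End Bridge.

(** * From the family of sizes and multiplicities to a function on all sizes, extended by zero *)

Section TypeOfFamily.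

Variables (s : nat) (i m : 'I_s -> nat).
Hypothesis i_inj : injective i.

Definition multiplicity (v : nat) : nat := (\sum_(j < s | i j == v) m j)%N.

Lemma multiplicity_at j : multiplicity (i j) = m j.
Proof.
by rewrite /multiplicity (big_pred1 j) // => l; rewrite inj_eq.
Qed.

Lemma multiplicity_gt0 v : (0 < multiplicity v)%N -> exists j, i j = v.
Proof.
rewrite lt0n => nz; suff /existsP[j /eqP] : [exists j, i j == v] by exists j.
apply: contraNT nz => /existsPn h.
by rewrite /multiplicity big_pred0 // => j; apply/negbTE/h.
Qed.

Lemma sum_multiplicity M (F : nat -> nat) : (forall j, i j < M)%N ->
  (\sum_(v < M) multiplicity v * F v = \sum_(j < s) m j * F (i j))%N.
Proof.
move=> iM.
rewrite [RHS](partition_big (fun j => Ordinal (iM j)) xpredT) //=.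
apply: eq_bigr => v _; rewrite /multiplicity big_distrl /=.
by apply: eq_big => [|j /eqP->].
Qed.

Lemma prod_fact_multiplicity M : (forall j, i j < M)%N ->
  (\prod_(v < M) (multiplicity v)`! = \prod_(j < s) (m j)`!)%N.
Proof.
move=> iM.
rewrite [RHS](partition_big (fun j => Ordinal (iM j)) xpredT) //=.
apply: eq_bigr => v _.
have [/existsP[j /eqP Ej]|/existsPn h] := boolP [exists j, i j == v].
  rewrite -Ej multiplicity_at (big_pred1 j) // => l.
  by rewrite -val_eqE /= -Ej inj_eq.
by rewrite /multiplicity !big_pred0 // => j; apply/negbTE/h.
Qed.

End TypeOfFamily.

(** * Transfer of the geometric count to [count_typeE] *)

Theorem corollary4p2 (R : realFieldType) (n k s : nat) (i m : 'I_s -> nat)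
    (p : 'I_n.+1 -> 'rV[R]_2)
    (hn : (2 <= n)%N) (hk : (1 <= k <= n - 1)%N) (hs : (1 <= s)%N)
    (hi : forall j, (3 <= i j <= n + 1)%N)
    (hi_inc : forall j l : 'I_s, (j < l)%N -> (i j < i l)%N)
    (hm : forall j, (0 < m j)%N)
    (hmk : (\sum_(j < s) m j)%N = k)
    (him : (\sum_(j < s) i j * m j)%N = (n + 2 * k - 1)%N)
    (hp : convex_polygon p) :
  #|dissections_of_type p (k - 1) i m|%:R
    = ((n + k - 1)`!)%:R / ((n`!)%:R * \prod_(j < s) ((m j)`!)%:R) :> rat.
Proof.
have i_inj : injective i.
  move=> j l E; apply: val_inj; case: (ltngtP (val j) (val l)) => // /hi_inc.
    by rewrite E ltnn.
  by rewrite E ltnn.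
have N3 : (3 <= n.+1)%N by [].
have iM j : (i j < n.+2)%N by have := hi j; lia.
case: k => [|k] in hk hmk him *; first by case/andP: hk.
pose t := multiplicity i m.
have t3 v : (v < 3)%N -> t v = 0%N.
  move=> v3; apply/eqP; rewrite -leqn0 leqNgt; apply: contraL v3.
  by case/multiplicity_gt0=> j <-; rewrite -leqNgt; case/andP: (hi j).
have st : (\sum_(v < n.+2) t v = k.+1)%N.
  have := sum_multiplicity m (fun=> 1%N) iM; rewrite -hmk.
  by under eq_bigr do rewrite muln1; under [in RHS]eq_bigr do rewrite muln1.
(* Subtracting the number [k.+1] of pieces from the edge total [n + 2 * k.+1 - 1] leaves [n + k]. *)
have wt : (\sum_(v < n.+2) t v * v.-1 = n + k)%N.
  rewrite (sum_multiplicity m predn iM).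
  have : (\sum_(j < s) m j * (i j).-1 + \sum_(j < s) m j = \sum_(j < s) i j * m j)%N.
    rewrite -big_split; apply: eq_bigr => j _ /=.
    by rewrite -mulnSr prednK 1?mulnC //; case/andP: (hi j); lia.
  by rewrite hmk him; lia.
have -> : dissections_of_type p (k.+1 - 1) i m = [set D | of_type t D].
  apply/setP=> D; rewrite !inE subn1 /=; apply/asboolP/idP.
    case=> /(is_dissectionE hp N3) nc cD [mi im]; apply/andP; split=> //.
    apply/forallP=> v; rewrite -(multE_sides hp N3) //.
    have [/existsP[j /eqP <-]|/existsPn h] := boolP [exists j, i j == v].
      by rewrite mi /t multiplicity_at.
    (* For a size outside the family both sides vanish: [t] by definition, and the number of pieces
       by the second clause of [has_type]. *)
    have -> : t v = 0%N.
      by apply/eqP; rewrite -leqn0 leqNgt; apply/negP=> /multiplicity_gt0[j];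
        move/eqP; apply/negP/h.
    rewrite cards_eq0; apply/eqP/setP=> V; rewrite in_set in_set0; apply/negP.
    by case/andP=> /im[j Ej] /eqP Ev; have := h j; rewrite -Ej Ev eqxx.
  move=> ty; have /andP[nc /forallP mt] := ty.
  have mtv (v : nat) (vM : (v < n.+2)%N) : mult D v = t v.
    exact/eqP/(mt (Ordinal vM)).
  split; first exact/(is_dissectionE hp N3).
    exact: (of_type_card N3 ty st).
  split=> [j|V pV]; first by rewrite (multE_sides hp N3) // mtv // /t multiplicity_at.
  have pV' : V \in cpieces D by rewrite -(piecesE hp N3).
  have V3 : (3 <= #|V|)%N by move: pV'; rewrite inE => /and3P[].
  (* The size of an actual piece has positive multiplicity in [t], hence is one of the [i j]. *)
  have := mult_gt0 pV'; rewrite mtv ?card_lt //.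
  by case/multiplicity_gt0=> j Ej; exists j; rewrite card_sides.
have := count_typeE N3 (erefl n.+1) t3 st wt.
rewrite (prod_fact_multiplicity m i_inj iM) /count_type.
rewrite addnS subn1 /= => <-.
rewrite -natr_prod -!natrM natrM mulfK // pnatr_eq0 -lt0n muln_gt0 fact_gt0.
by apply: prodn_gt0 => j; apply: fact_gt0.
Qed.
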